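(* Let $f=x^{24}+x+t\in\mathbb{F}_2(t)[x]$. The $24$ roots of $f$ in a splitting field over $\mathbb{F}_2(t)$ form a Steiner system $S(5,8,24)$ whose blocks are the sets of eight distinct roots of $f$ that sum to $0$ (that is, every set of five distinct roots of $f$ is contained in exactly one set of eight distinct roots whose sum is $0$). There are exactly $759$ sets of eight distinct roots of $f$ that sum to $0$.
   Context: A $2$-polynomial over a field $F$ of characteristic $2$ is a polynomial of the form $\sum_{i=0}^n a_i x^{2^i}\in F[x]$, and its $2$-degree is $n$ if $a_n\neq 0$. The minimal $2$-polynomial of a polynomial $f\in F[x]$ without repeated roots is the unique monic $2$-polynomial over $F$ of smallest $2$-degree that is divisible by $f$; its set of roots is the $\mathbb{F}_2$-span of the roots of $f$. Standing facts assumed (established by computer algebra): the polynomial $f=x^{24}+x+t$ is irreducible over $\mathbb{F}_2(t)$; its minimal $2$-polynomial over $\mathbb{F}_2(t)$ is $$L=x^{4096} + (t^{24} + t)x^{2048} + t^{128}x^{1024} + (t^{88} +t^{65})x^{512} + t^{16}x^{32} +t^9x^{16} + (t^{40} + t^{17})x^8 + x^2 + (t^{24} + t)x,$$ which has $2$-degree $12$; and the irreducible factors of $L$ over $\mathbb{F}_2(t)$ have degrees $1, 24, 276, 1771, 2024$. Nothing is assumed about the Galois group of $f$. A Steiner system $S(5,8,24)$ is a set of $24$ points with a collection of $8$-element subsets (blocks) such that every $5$-element subset lies in exactly one block. *)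

(* Defs.v *)
From HB Require Import structures.
From mathcomp Require Import all_boot all_order all_algebra all_field.
From mathcomp Require Import finmap.

Set Implicit Arguments.
Unset Strict Implicit.
Unset Printing Implicit Defensive.

Import GRing.Theory.
Local Open Scope ring_scope.
Local Open Scope fset_scope.

(* The next two notions are only meant for fields of characteristic 2. *)
Definition two_degree (F : fieldType) (p : {poly F}) (n : nat) : Prop :=
  exists a : nat -> F,
    a n != 0 /\ p = \sum_(i < n.+1) a i *: 'X^(2 ^ i).

(* A monic polynomial is nonzero, so p is a 2-polynomial exactly when it has
   some 2-degree. *)
Definition minimal_two_poly (F : fieldType) (f p : {poly F}) : Prop :=
  exists n : nat,
    [/\ two_degree p n, p \is monic, f %| p
      & forall (q : {poly F}) (m : nat),
          two_degree q m -> q \is monic -> f %| q -> (n <= m)%N].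

(* Degrees are counted with multiplicity and listed in any order. *)
Definition irreducible_factor_degrees
    (F : fieldType) (p : {poly F}) (ds : seq nat) : Prop :=
  exists qs : seq {poly F},
    [/\ forall q, q \in qs -> irreducible_poly q,
        p %= \prod_(q <- qs) q
      & perm_eq [seq (size (q : {poly F})).-1 | q <- qs] ds].

(* Steiner system S(t, k, n) on the point set P with block set B. *)
Definition steiner_system (t k n : nat) (T : choiceType)
    (P : {fset T}) (B : {fset {fset T}}) : Prop :=
  [/\ #|` P| = n,
      forall b, b \in B -> b `<=` P /\ #|` b| = k
    & forall A : {fset T}, A `<=` P -> #|` A| = t ->
        exists! b : {fset T}, b \in B /\ A `<=` b].

Definition zero_sum_subsets (V : zmodType) (k : nat) (P : {fset V}) :
    {fset {fset V}} :=
  [fset S in fpowerset P | (#|` S| == k) && (\sum_(x <- S) x == 0)].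

Definition F2t : fieldType := {fraction {poly 'F_2}}.

Definition F2t_t : F2t := tofrac ('X : {poly 'F_2}).

Local Notation t := F2t_t.

Definition f24 : {poly F2t} := 'X^24 + 'X + t%:P.

(* The powers of 'X are 4096, 2048, 1024, 512, 32, 16, 8, 2 and 1. *)
Definition L24 : {poly F2t} :=
  'X^(2 ^ 12) + (t ^+ 24 + t) *: 'X^(2 ^ 11) + t ^+ 128 *: 'X^(2 ^ 10)
  + (t ^+ 88 + t ^+ 65) *: 'X^(2 ^ 9) + t ^+ 16 *: 'X^(2 ^ 5)
  + t ^+ 9 *: 'X^(2 ^ 4) + (t ^+ 40 + t ^+ 17) *: 'X^(2 ^ 3)
  + 'X^2 + (t ^+ 24 + t) *: 'X.

(* Main.v *)
Require Import Defs.
From HB Require Import structures.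
From mathcomp Require Import all_boot all_order all_algebra all_field.
From mathcomp Require Import all_fingroup.
From mathcomp Require Import finmap zify.

(* Write N_k(v) for the number of k-subsets of the 24 roots with sum v.  The
   roots of a 2-polynomial are closed under addition, so every subset sum is a
   root of L, hence a root of exactly one irreducible factor of L.  The roots
   of an irreducible factor q of degree d form one Galois orbit, so N_k takes a
   constant value m_k(d) on them and C(24, k) = sum_d d * m_k(d), with d in
   {1, 24, 276, 1771, 2024}.  Once zero-sum sets of size at most n are excluded,
   m_k vanishes on the orbit of a j-subset sum for j <> k and j + k <= n, and the
   equations have a unique solution:
     276   = 24 a + 276 b + 1771 c + 2024 d  forces b = 1       (k = 2, n = 2),
     2024  = 276 b + 1771 c + 2024 d         forces d = 1       (k = 3, n = 4),
     10626 = 1771 c + 2024 d                 forces c = 6       (k = 4, n = 6).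
   Thus the 2-subset, 3-subset and 4-subset sums fill the orbits of sizes 276,
   2024 and 1771, and there is no nonempty zero-sum set of size at most 7.  The
   six 4-subsets with a given sum are then disjoint and partition the roots;
   the one through a fifth point completes any 5-subset to a unique octad, and
   there are C(24, 5) / C(8, 5) = 759 octads. *)

Set Implicit Arguments.
Unset Strict Implicit.
Unset Printing Implicit Defensive.

Import GRing.Theory.
Local Open Scope ring_scope.

(** * Subset sums in an elementary abelian 2-group *)

Definition factor_degrees : seq nat := [:: 1; 24; 276; 1771; 2024]%N.

Section SubsetSums.

Variables (T : finType) (V : zmodType) (phi : T -> V).
Hypothesis addvv : forall v : V, v + v = 0.
Implicit Types (S A B C : {set T}) (v : V).

Definition subset_sum S := \sum_(x in S) phi x.

Definition ksubsets k v :=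
  [set S : {set T} | (#|S| == k) && (subset_sum S == v)].

(** The zero-sum subsets form a binary linear code under symmetric difference; this says that its
    minimum weight exceeds [n]. *)
Definition no_zero_sum_upto n :=
  forall S, subset_sum S = 0 -> (#|S| <= n)%N -> S = set0.

Lemma subset_sumU A B :
  [disjoint A & B] -> subset_sum (A :|: B) = subset_sum A + subset_sum B.
Proof.
by move=> dAB; rewrite /subset_sum -bigU //; apply: eq_bigl => x; rewrite !inE.
Qed.

Lemma addv_eq0 u v : u + v = 0 -> u = v.
Proof. by move=> uv0; rewrite -[u]addr0 -(addvv v) addrA uv0 add0r. Qed.

Lemma setDD_disjoint A B : [disjoint A :\: B & B :\: A].
Proof.
rewrite -setI_eq0; apply/eqP/setP=> x; rewrite !inE.
by case: (x \in A); case: (x \in B).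
Qed.

Lemma subset_sum_symdiff A B :
  subset_sum ((A :\: B) :|: (B :\: A)) = subset_sum A + subset_sum B.
Proof.
rewrite subset_sumU ?setDD_disjoint //.
rewrite [subset_sum A](big_setID B) [subset_sum B](big_setID A) /= (setIC B).
by rewrite addrACA addvv add0r.
Qed.

(** A known common part [C] disappears from both sides of the symmetric difference; with [C] empty
    only the trivial bound remains. *)
Lemma card_symdiff_sub A B C : C \subset A -> C \subset B ->
  (#|(A :\: B) :|: (B :\: A)| + #|C|.*2 <= #|A| + #|B|)%N.
Proof.
move=> sCA sCB; have sCAB: (#|C| <= #|A :&: B|)%N.
  by rewrite subset_leq_card // subsetI sCA.
have [+ _] := leq_card_setU (A :\: B) (B :\: A).
have := cardsID B A; have := cardsID A B; rewrite (setIC B).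
lia.
Qed.

(** In characteristic 2 the symmetric difference has sum zero, so it is empty once it is small. *)
Lemma subset_sum_inj n A B : no_zero_sum_upto n ->
  subset_sum A = subset_sum B ->
  (#|(A :\: B) :|: (B :\: A)| <= n)%N -> A = B.
Proof.
move=> nz eqAB leAB; have := subset_sum_symdiff A B.
rewrite eqAB addvv => /nz/(_ leAB)/eqP; rewrite setU_eq0 => /andP[].
by rewrite !setD_eq0 => sAB sBA; apply/eqP; rewrite eqEsubset sAB.
Qed.

Lemma ksubsets_eq0 n j k S : no_zero_sum_upto n -> #|S| = j ->
  j != k -> (j + k <= n)%N -> #|ksubsets k (subset_sum S)| = 0%N.
Proof.
move=> nz Sj neqjk le_n; apply: eq_card0 => B; rewrite !inE.
apply/andP=> -[/eqP Bk /eqP /esym eqSB].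
have eqS: S = B.
  apply: (subset_sum_inj nz eqSB).
  by have := card_symdiff_sub (sub0set S) (sub0set B); rewrite cards0; lia.
by case/eqP: neqjk; rewrite -Sj -Bk eqS.
Qed.

(** Cut a zero-sum set of size [n.+1] into parts of sizes [j] and [k]: since [v = -v], the two parts
    have the same sum. *)
Lemma no_zero_sumS n j k : no_zero_sum_upto n -> (j + k = n.+1)%N ->
  (forall A B, #|A| = j -> #|B| = k -> [disjoint A & B] ->
     subset_sum A = subset_sum B -> False) ->
  no_zero_sum_upto n.+1.
Proof.
move=> nz jk split S S0; rewrite leq_eqVlt ltnS => /predU1P[Sn|]; last exact: nz.
have: (j <= #|S|)%N by rewrite Sn -jk leq_addr.
case/card_geqP=> s [s_uniq s_size sS].
pose A := [set x in s].
have sAS: A \subset S by apply/subsetP=> x; rewrite inE => /sS.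
have Aj: #|A| = j by rewrite cardsE (card_uniqP s_uniq).
have dAB: [disjoint A & S :\: A].
  by rewrite -setI_eq0 setIC setIDAC setDIl setDv setI0.
case: (split A (S :\: A)) => //.
  by rewrite cardsD (setIidPr sAS) Sn Aj -jk addKn.
apply: addv_eq0; rewrite -subset_sumU // -[RHS]S0; congr subset_sum.
by rewrite setDE setUIr setUCr setIT; apply/setUidPr.
Qed.

(** * Counting subset sums by orbit class *)

Section OrbitClasses.

(* [O d] will be the set of roots of the irreducible factor of degree [d]. *)
Variable O : nat -> pred V.
Hypothesis card_T : #|T| = 24%N.
Hypothesis O_unique :
  forall S, count (fun d => O d (subset_sum S)) factor_degrees = 1%N.
Hypothesis O_card : forall d k : nat, d \in factor_degrees ->
  exists m, (forall v, O d v -> #|ksubsets k v| = m)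
    /\ #|[set S : {set T} | (#|S| == k) && O d (subset_sum S)]| = (d * m)%N.
Hypothesis phi_inj : injective phi.
Hypothesis O1_0 : O 1 0.
Hypothesis O24_phi : forall x, O 24 (phi x).

(** Every k-subset is counted once, in the class of its sum, and each class contributes its degree
    times its multiplicity. *)
Lemma ksubsets_class_equation (k : nat) : exists m1 m24 m276 m1771 m2024,
  [/\ forall v, O 1 v -> #|ksubsets k v| = m1,
      forall v, O 24 v -> #|ksubsets k v| = m24,
      forall v, O 276 v -> #|ksubsets k v| = m276
    & (forall v, O 1771 v -> #|ksubsets k v| = m1771) /\
      (forall v, O 2024 v -> #|ksubsets k v| = m2024)] /\
  'C(24, k) = (m1 + 24 * m24 + 276 * m276 + 1771 * m1771 + 2024 * m2024)%N.
Proof.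
have [m1 [O1 c1]] := O_card k (isT : 1%N \in factor_degrees).
have [m2 [O2 c2]] := O_card k (isT : 24%N \in factor_degrees).
have [m3 [O3 c3]] := O_card k (isT : 276%N \in factor_degrees).
have [m4 [O4 c4]] := O_card k (isT : 1771%N \in factor_degrees).
have [m5 [O5 c5]] := O_card k (isT : 2024%N \in factor_degrees).
exists m1, m2, m3, m4, m5; split=> //.
have -> : 'C(24, k) = #|[set S : {set T} | #|S| == k]| by rewrite card_draws card_T.
rewrite -[m1]mul1n -c1 -c2 -c3 -c4 -c5.
have cardE d : #|[set S : {set T} | (#|S| == k) && O d (subset_sum S)]|
    = (\sum_(S : {set T} | #|S| == k) (O d (subset_sum S) : nat))%N.
  by rewrite -sum1dep_card big_mkcondr; apply: eq_bigr => S _; case: (O _ _).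
rewrite !cardE -!big_split -sum1_card /=.
apply: eq_big => S; rewrite inE // => _.
by rewrite -[LHS](O_unique S) /= !addnA addn0.
Qed.

Lemma subset_sum_class S :
  O 1 (subset_sum S) \/ O 24 (subset_sum S) \/ O 276 (subset_sum S) \/
  O 1771 (subset_sum S) \/ O 2024 (subset_sum S).
Proof.
have: has (fun d => O d (subset_sum S)) factor_degrees.
  by rewrite has_count O_unique.
by rewrite /= orbF => /orP[|/orP[|/orP[|/orP[]]]]; tauto.
Qed.

Lemma ksubsets_sum S k : #|S| = k -> (0 < #|ksubsets k (subset_sum S)|)%N.
Proof. by move=> Sk; apply/card_gt0P; exists S; rewrite !inE Sk !eqxx. Qed.


(** The multiplicity is constant on a class, so one j-subset sum in the class suffices to show that
    it vanishes. *)
Lemma class_card_eq0 n j k d m S : no_zero_sum_upto n -> O d (subset_sum S) ->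
  #|S| = j -> (forall v, O d v -> #|ksubsets k v| = m) ->
  j != k -> (j + k <= n)%N -> m = 0%N.
Proof. by move=> nz OS Sj em; rewrite -(em _ OS); apply: ksubsets_eq0. Qed.

Lemma ksubsets_card1_inj k A B : #|ksubsets k (subset_sum A)| = 1%N ->
  #|A| = k -> #|B| = k -> subset_sum A = subset_sum B -> A = B.
Proof.
move/eqP/cards1P=> [C defC] Ak Bk eqAB.
have: A \in ksubsets k (subset_sum A) by rewrite inE Ak !eqxx.
have: B \in ksubsets k (subset_sum A) by rewrite inE Bk eqAB !eqxx.
by rewrite defC !inE => /eqP-> /eqP->.
Qed.

Lemma disjoint_neq k A B : (0 < k)%N -> #|A| = k -> [disjoint A & B] -> A <> B.
Proof.
by move=> k0 Ak /[swap] <-; rewrite -setI_eq0 setIid -cards_eq0 Ak eqn0Ngt k0.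
Qed.

Lemma min_weight_and_sextets :
  no_zero_sum_upto 7 /\
  forall S, #|S| = 4%N -> #|ksubsets 4 (subset_sum S)| = 6%N.
Proof.
have /card_gt0P/sigW[x0 _] : (0 < #|T|)%N by rewrite card_T.
have sum1 x : subset_sum [set x] = phi x by rewrite /subset_sum big_set1.
have sum0 : subset_sum set0 = 0 by rewrite /subset_sum big_set0.
have O1_set0 : O 1 (subset_sum set0) by rewrite sum0.
have O24_set1 S : #|S| = 1%N -> O 24 (subset_sum S).
  by move/eqP/cards1P=> [x ->]; rewrite sum1.
have nz1 : no_zero_sum_upto 1.
  move=> S S0; rewrite leq_eqVlt ltnS leqn0 cards_eq0.
  case/predU1P=> [S1|/eqP//].
  (* A zero root would lie both in the class of 0 and in the class of the roots. *)
  have O1S : O 1 (subset_sum S) by rewrite S0.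
  by have := O_unique S; rewrite /= O1S O24_set1 //; lia.
have nz2 : no_zero_sum_upto 2.
  apply: (no_zero_sumS (j := 1) (k := 1) nz1) => // A B A1 B1 dAB eqAB.
  apply: (disjoint_neq _ A1 dAB) => //.
  move/eqP: A1 B1 eqAB => /cards1P[x ->] /eqP/cards1P[y ->].
  by rewrite !sum1 => /phi_inj->.
have [m1 [m24 [m276 [m1771 [m2024 [[e1 e24 e276 [e1771 e2024]] eq2]]]]]] :=
  ksubsets_class_equation 2.
have z1 := class_card_eq0 nz2 O1_set0 (cards0 _) e1 isT isT.
(* The two largest degrees exceed 276, and 276 is not a multiple of 24. *)
have [z24 z276 z1771 z2024] : [/\ m24 = 0, m276 = 1, m1771 = 0 & m2024 = 0]%N.
  by have : 'C(24, 2) = 276%N by []; split; lia.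
subst m1 m24 m276 m1771 m2024.
have O276_set2 S : #|S| = 2%N -> O 276 (subset_sum S).
  move=> S2; have := ksubsets_sum S2.
  by case: (subset_sum_class S) => [/e1 ->|[/e24 ->|[|[/e1771 ->|/e2024 ->]]]] //.
(* A root that is also a pair sum would put a pair sum in class 24, where the multiplicity of pairs
   is 0. *)
have nz3 : no_zero_sum_upto 3.
  apply: (no_zero_sumS (j := 1) (k := 2) nz2) => // A B A1 B2 _ eqAB.
  by have := ksubsets_sum B2; rewrite -eqAB e24 ?O24_set1.
have nz4 : no_zero_sum_upto 4.
  apply: (no_zero_sumS (j := 2) (k := 2) nz3) => // A B A2 B2 dAB eqAB.
  apply: (disjoint_neq _ A2 dAB) => //.
  by apply: (ksubsets_card1_inj _ A2 B2 eqAB); rewrite e276 ?O276_set2.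
clear e1 e24 e276 e1771 e2024 eq2.
have [m1 [m24 [m276 [m1771 [m2024 [[e1 e24 e276 [e1771 e2024]] eq3]]]]]] :=
  ksubsets_class_equation 3.
have z1 := class_card_eq0 nz4 O1_set0 (cards0 _) e1 isT isT.
have z24 := class_card_eq0 nz4 (O24_set1 _ (cards1 x0)) (cards1 x0) e24 isT isT.
(* Neither 2024 nor 2024 - 1771 = 253 is a multiple of 276. *)
have [z276 z1771 z2024] : [/\ m276 = 0, m1771 = 0 & m2024 = 1]%N.
  by have : 'C(24, 3) = 2024%N by []; split; lia.
subst m1 m24 m276 m1771 m2024.
have O2024_set3 S : #|S| = 3%N -> O 2024 (subset_sum S).
  move=> S3; have := ksubsets_sum S3.
  by case: (subset_sum_class S) => [/e1 ->|[/e24 ->|[/e276 ->|[/e1771 ->|]]]] //.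
have nz5 : no_zero_sum_upto 5.
  apply: (no_zero_sumS (j := 2) (k := 3) nz4) => // A B A2 B3 _ eqAB.
  by have := ksubsets_sum B3; rewrite -eqAB e276 ?O276_set2.
have nz6 : no_zero_sum_upto 6.
  apply: (no_zero_sumS (j := 3) (k := 3) nz5) => // A B A3 B3 dAB eqAB.
  apply: (disjoint_neq _ A3 dAB) => //.
  by apply: (ksubsets_card1_inj _ A3 B3 eqAB); rewrite e2024 ?O2024_set3.
clear e1 e24 e276 e1771 e2024 eq3.
have [m1 [m24 [m276 [m1771 [m2024 [[e1 e24 e276 [e1771 e2024]] eq4]]]]]] :=
  ksubsets_class_equation 4.
have z1 := class_card_eq0 nz6 O1_set0 (cards0 _) e1 isT isT.
have z24 := class_card_eq0 nz6 (O24_set1 _ (cards1 x0)) (cards1 x0) e24 isT isT.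
(* Any pair will do: its sum lies in class 276, which excludes 4-subset sums from that class. *)
have [S2 cardS2] : exists S, #|S| = 2%N.
  have /card_geqP[s [s_uniq s_size _]] : (2 <= #|T|)%N by rewrite card_T.
  by exists [set x in s]; rewrite cardsE (card_uniqP s_uniq).
have z276 := class_card_eq0 nz6 (O276_set2 _ cardS2) cardS2 e276 isT isT.
(* Dividing by 253 leaves 42 = 7 c + 8 d, so 7 divides d, and d = 7 is too large. *)
have [z1771 z2024] : m1771 = 6%N /\ m2024 = 0%N.
  have : 'C(24, 4) = (6 * 1771)%N by vm_compute.
  by split; lia.
subst m1 m24 m276 m1771 m2024; split=> [|S S4].
  apply: (no_zero_sumS (j := 3) (k := 4) nz6) => // A B A3 B4 _ eqAB.
  by have := ksubsets_sum B4; rewrite -eqAB e2024 ?O2024_set3.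
have := ksubsets_sum S4.
by case: (subset_sum_class S)
  => [/e1 ->|[/e24 ->|[/e276 ->|[/e1771 ->|/e2024 ->]]]] //.
Qed.

End OrbitClasses.

(** * Sextets and octads *)

Section Octads.

Hypothesis nz7 : no_zero_sum_upto 7.

(** The symmetric difference has at most [2k - 2|C|] elements, hence at most 7. It is used for
    4-sets sharing a point and octads sharing five points. *)
Lemma ksubsets_agree k v A B C : A \in ksubsets k v -> B \in ksubsets k v ->
  C \subset A -> C \subset B -> (k.*2 <= 7 + #|C|.*2)%N -> A = B.
Proof.
rewrite !inE => /andP[/eqP Ak /eqP Av] /andP[/eqP Bk /eqP Bv] sCA sCB le_k.
apply: (subset_sum_inj nz7); first by rewrite Av Bv.
by have := card_symdiff_sub sCA sCB; lia.
Qed.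

Lemma octad_unique A B C : #|A| = 5%N ->
  B \in ksubsets 8 0 -> C \in ksubsets 8 0 -> A \subset B -> A \subset C -> B = C.
Proof.
by move=> A5 oB oC sAB sAC; apply: (ksubsets_agree oB oC sAB sAC); rewrite A5.
Qed.

Hypothesis card_T : #|T| = 24%N.
Hypothesis sextet : forall S, #|S| = 4%N -> #|ksubsets 4 (subset_sum S)| = 6%N.

(** Two 4-subsets with the same sum that meet are equal, so the six are disjoint and fill all 24
    points. *)
Lemma sextet_cover S : #|S| = 4%N -> cover (ksubsets 4 (subset_sum S)) = setT.
Proof.
move=> S4; set Q := ksubsets 4 _.
have trivQ : trivIset Q.
  apply/trivIsetP=> A B QA QB; apply: contraNT => /pred0Pn[x /andP[Ax Bx]].
  by apply/eqP/(ksubsets_agree (C := [set x]) QA QB); rewrite ?sub1set ?cards1.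
apply/eqP; rewrite eqEcard subsetT cardsT card_T.
rewrite -(eqP trivQ) (eq_bigr (fun=> 4%N)) => [|A].
  by rewrite sum_nat_const sextet.
by rewrite !inE => /andP[/eqP].
Qed.

Lemma octad_exists A : #|A| = 5%N -> exists2 B, B \in ksubsets 8 0 & A \subset B.
Proof.
move=> A5; have [x Ax] : exists x, x \in A by apply/card_gt0P; rewrite A5.
have S4 : #|A :\ x| = 4%N by have := cardsD1 x A; rewrite Ax A5; lia.
have: x \in cover (ksubsets 4 (subset_sum (A :\ x))) by rewrite sextet_cover.
case/bigcupP=> D QD Dx; have QA : A :\ x \in ksubsets 4 (subset_sum (A :\ x)).
  by rewrite inE S4 !eqxx.
have dAD : [disjoint A :\ x & D].
  apply/pred0P=> y; apply/andP=> -[/= Ay Dy].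
  (* Two members of a sextet that meet coincide, but [x] lies only in [D]. *)
  suff eqD : A :\ x = D by move: Dx; rewrite -eqD !inE eqxx.
  by apply: (ksubsets_agree (C := [set y]) QA QD); rewrite ?sub1set ?cards1.
move: QD; rewrite !inE => /andP[/eqP D4 /eqP sumD].
exists ((A :\ x) :|: D); last first.
  by rewrite -{1}(setD1K Ax) subUset sub1set inE Dx orbT subsetUl.
rewrite inE subset_sumU // sumD addvv eqxx andbT.
by rewrite cardsU disjoint_setI0 // cards0 S4 D4.
Qed.

(** Pairs of a 5-subset and an octad containing it are counted in both orders. *)
Lemma card_octads : #|ksubsets 8 0| = 759%N.
Proof.
have eqC : (\sum_(A : {set T} | #|A| == 5) 1 = #|ksubsets 8 0| * 'C(8, 5))%N.
  transitivity (\sum_(A : {set T} | #|A| == 5)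
                  \sum_(B in ksubsets 8 0 | A \subset B) 1)%N.
    apply: eq_bigr => A /eqP A5; have [B oB sAB] := octad_exists A5.
    rewrite (big_pred1 B) // => C; apply/andP/eqP => [[oC sAC] | ->//].
    exact: octad_unique A5 oC oB sAC sAB.
  rewrite (exchange_big_dep (mem (ksubsets 8 0))) /=; last by move=> A B _ /andP[].
  rewrite -sum_nat_const; apply: eq_bigr => B oB.
  have/andP[/eqP B8 _] : (#|B| == 8%N) && (subset_sum B == 0) by rewrite inE in oB.
  have <- : #|[set A : {set T} | A \subset B & #|A| == 5]| = 'C(8, 5).
    by rewrite cards_draws B8.
  rewrite -sum1dep_card; apply: eq_bigl => A.
  by rewrite oB andbC.
move: eqC; rewrite sum1dep_card card_draws card_T.
have -> : 'C(8, 5) = 56%N by [].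
have -> : 'C(24, 5) = (759 * 56)%N.
  (* The identity 5 C(24, 5) = 20 C(24, 4) reduces the value to a smaller binomial. *)
  have := mul_bin_left 24 4; have -> : 'C(24, 4) = (6 * 1771)%N by vm_compute.
  lia.
by move/eqP; rewrite eqn_pmul2r // => /eqP.
Qed.

End Octads.

End SubsetSums.

(** * From subsets of a finite type to finite sets *)

Section Transfer.
Local Open Scope fset_scope.

Variables (V : zmodType) (P : {fset V}).

Lemma fsetval_subset (X : {set P}) : [fsetval x in X] `<=` P.
Proof. by apply/fsubsetP=> _ /imfsetP[x _ ->]; apply: valP. Qed.

Lemma sum_fsetval (X : {set P}) :
  \sum_(x <- [fsetval x in X]) x = subset_sum val X.
Proof. by rewrite big_imfset /= => [|x y _ _ /val_inj//]; rewrite big_enum. Qed.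

Lemma card_fsetval (X : {set P}) : #|` [fsetval x in X]| = #|X|.
Proof. by rewrite card_imfset ?cardE //; apply: val_inj. Qed.

Lemma fsetval_zero_sum k (X : {set P}) :
  ([fsetval x in X] \in zero_sum_subsets k P) = (X \in ksubsets val k 0).
Proof.
by rewrite !inE fpowersetE fsetval_subset sum_fsetval card_fsetval.
Qed.

Lemma zero_sum_subsetP k (B : {fset V}) : B \in zero_sum_subsets k P ->
  exists2 X : {set P}, X \in ksubsets val k 0 & B = [fsetval x in X].
Proof.
move=> oB; have sBP : B `<=` P by move: oB; rewrite !inE fpowersetE => /andP[].
by exists (fsub P B); rewrite -?fsetval_zero_sum fsubK.
Qed.

Lemma card_zero_sum_subsets k :
  #|` zero_sum_subsets k P| = #|ksubsets (val : P -> V) k 0|.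
Proof.
have -> : zero_sum_subsets k P
    = [fset [fsetval x in X : {set P}] | X in ksubsets (val : P -> V) k 0].
  apply/fsetP=> B; apply/idP/imfsetP => [/zero_sum_subsetP[X] | [X oX ->]].
    by exists X.
  by rewrite fsetval_zero_sum.
by rewrite card_imfset ?cardE // => X Y eqXY; rewrite -(FSetK X) eqXY FSetK.
Qed.

Lemma steiner_system_fsetval t k n : #|` P| = n ->
  (forall A : {set P}, #|A| = t ->
     exists2 B, B \in ksubsets (val : P -> V) k 0 & A \subset B) ->
  (forall A B C : {set P}, #|A| = t ->
     B \in ksubsets (val : P -> V) k 0 -> C \in ksubsets (val : P -> V) k 0 ->
     A \subset B -> A \subset C -> B = C) ->
  steiner_system t k n P (zero_sum_subsets k P).
Proof.
move=> cardP exB uniqB; split=> // [B | A sAP At].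
  by rewrite !inE fpowersetE => /and3P[-> /eqP].
have At' : #|fsub P A| = t by rewrite card_fsub.
have [B oB sAB] := exB _ At'; exists [fsetval x in B].
split=> [|_ [/zero_sum_subsetP[C oC ->]]].
  split; first by rewrite fsetval_zero_sum.
  by rewrite -(@subset_fsubE _ P) ?FSetK ?fsetval_subset.
rewrite -(@subset_fsubE _ P) ?FSetK ?fsetval_subset // => sAC.
by rewrite (uniqB _ _ _ At' oB oC).
Qed.

End Transfer.

(** * Galois orbits of subset sums *)

Section GaloisOrbits.

Variables (F : fieldType) (E : splittingFieldType F).
Local Notation "p ^%E" := (map_poly (in_alg E) p) (at level 2, format "p ^%E").
Local Notation G := 'Gal({:E} / 1)%g.

(** The minimal polynomial over the base field descends to [F], divides [q] and is not constant. *)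
Lemma minPoly1_eqp (q : {poly F}) (v : E) :
  irreducible_poly q -> root q^%E v -> minPoly 1 v %= q^%E.
Proof.
move=> [_ irr_q] qv.
have /polyOver1P[p def_p] := minPolyOver 1 v.
have: minPoly 1 v %| q^%E by apply: minPoly_dvdp => //; apply: alg_polyOver.
rewrite def_p dvdp_map eqp_map => /irr_q-> //.
rewrite -(size_map_poly (in_alg E)) -def_p size_minPoly.
by [].
Qed.

Hypothesis galE : galois 1 {:E}.

(** Over a Galois extension the minimal polynomial of [v] is the product of the linear factors of
    its distinct conjugates. *)
Lemma galois_orbit (q : {poly F}) (v : E) :
  irreducible_poly q -> root q^%E v ->
  exists s : seq E, [/\ uniq s, size s = (size q).-1,
    forall b, root q^%E b = (b \in s)
    & forall b, b \in s -> exists2 x : gal_of {:E}, x \in G & b = x v].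
Proof.
move=> irr_q qv; have eq_q := minPoly1_eqp irr_q qv.
have /galois_factors/(_ galE v (memvf v))[r /=] := sub1v {:E}.
set s := map _ _ => -[/subsetP rG s_uniq def_p].
exists s; split=> // [|b|b /mapP[x rx ->]].
- by rewrite -(size_map_poly (in_alg E)) -(eqp_size eq_q) def_p size_prod_XsubC.
- by rewrite -(eqp_root eq_q) def_p root_prod_XsubC.
by exists x => //; apply: rG.
Qed.

Section Counting.

Local Open Scope fset_scope.
Variable P : {fset E}.
Hypothesis P_stable : forall x : gal_of {:E}, x \in G ->
  forall a, a \in P -> x a \in P.
Local Notation w := (subset_sum (val : P -> E)).
Local Notation N := (ksubsets (val : P -> E)).

(** An automorphism permutes [P] and carries k-subsets with sum [v] injectively to k-subsets with
    sum [x v]; its inverse then gives equality. *)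
Lemma card_ksubsets_gal_le (x : gal_of {:E}) k v :
  x \in G -> (#|N k v| <= #|N k (x v)|)%N.
Proof.
move=> Gx; pose h (a : P) : P := [` P_stable Gx (valP a)].
have h_inj : injective h.
  by move=> a b /(congr1 val)/= /fmorph_inj/val_inj.
rewrite -(card_imset _ (imset_inj h_inj)); apply/subset_leq_card/subsetP.
move=> _ /imsetP[S + ->]; rewrite !inE card_imset // => /andP[-> /eqP <-] /=.
by rewrite /subset_sum big_imset ?rmorph_sum //=; apply: in2W.
Qed.

Lemma card_ksubsets_gal (x : gal_of {:E}) k v :
  x \in G -> #|N k (x v)| = #|N k v|.
Proof.
move=> Gx; apply/eqP; rewrite eqn_leq card_ksubsets_gal_le // andbT.
have {2}-> : v = x^-1%g (x v) by rewrite -galM ?memvf // mulgV gal_id.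
by rewrite card_ksubsets_gal_le ?groupVr.
Qed.

Lemma card_ksubsets_orbit (q : {poly F}) k : irreducible_poly q ->
  exists m, (forall v, root q^%E v -> #|N k v| = m) /\
    #|[set S : {set P} | (#|S| == k) && root q^%E (w S)]| = ((size q).-1 * m)%N.
Proof.
move=> irr_q; set R := [set S | _].
(* Either no k-subset sum is a root of [q] and [m = 0] works, or such a sum provides the root whose
   orbit is counted. *)
have [S0 | [S]] := set_0Vmem R.
  exists 0%N; rewrite muln0 S0 cards0; split=> // v qv; apply: eq_card0 => S.
  rewrite !inE; apply/negP=> /andP[Sk /eqP Sv].
  by have := in_set0 S; rewrite -S0 inE Sk Sv qv.
rewrite inE => /andP[/eqP Sk qS].
have [s [s_uniq s_size mem_s sG]] := galois_orbit irr_q qS.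
have Ns b : b \in s -> #|N k b| = #|N k (w S)|.
  by move=> /sG[x Gx ->]; apply: card_ksubsets_gal.
exists #|N k (w S)|; split=> [v|]; first by rewrite mem_s; apply: Ns.
rewrite -s_size -sum1dep_card big_mkcondr /=.
transitivity (\sum_(b <- s) #|N k b|)%N; last first.
  rewrite big_seq (eq_bigr (fun=> #|N k (w S)|)) // -big_seq big_const_seq.
  by rewrite count_predT iter_addn_0 mulnC.
under [RHS]eq_bigr do rewrite -sum1dep_card big_mkcondr.
rewrite exchange_big /=; apply: eq_bigr => A _; rewrite mem_s.
(* As [s] has no repetition, membership is a count, which matches the sum over [s] after exchanging
   summations. *)
have -> : (if w A \in s then 1 else 0)%N = count_mem (w A) s.
  by rewrite count_uniq_mem //; case: (_ \in _).
rewrite -big_mkcond /= sum1_count.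
by apply: eq_count => b; rewrite /= eq_sym.
Qed.

End Counting.

End GaloisOrbits.

(** * Roots of 2-polynomials and of irreducible factors *)

Lemma two_poly_root0 (F : fieldType) (E : fieldExtType F) (p : {poly F}) n :
  two_degree p n -> root (map_poly (in_alg E) p) 0.
Proof.
move=> [a [_ ->]]; rewrite rmorph_sum /= /root horner_sum big1 // => i _.
by rewrite map_polyZ map_polyXn hornerZ hornerXn expr0n expn_eq0 mulr0.
Qed.

(** Each monomial is a scalar multiple of an iterate of the Frobenius map, which is additive. *)
Lemma two_poly_hornerD (F : fieldType) (E : fieldExtType F) (p : {poly F}) n
    (u v : E) :
  2%N \in [pchar F] -> two_degree p n ->
  (map_poly (in_alg E) p).[u + v]
    = (map_poly (in_alg E) p).[u] + (map_poly (in_alg E) p).[v].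
Proof.
move=> char2 [a [_ ->]]; rewrite rmorph_sum /= !horner_sum -big_split /=.
apply: eq_bigr => i _.
rewrite map_polyZ map_polyXn !hornerZ !hornerXn -mulrDr exprDn_pchar //.
by rewrite pnatX pnatE // (fmorph_pchar (in_alg E)) ?char2.
Qed.

Lemma map_uniq_inj (T U : eqType) (g : T -> U) (s : seq T) :
  uniq (map g s) -> {in s &, injective g}.
Proof.
elim: s => //= a s IHs /andP[gaNs us] x y; rewrite !inE.
case/predU1P=> [->|xs] /predU1P[->|ys] // eqg; last exact: IHs.
  by rewrite eqg map_f in gaNs.
by rewrite -eqg map_f in gaNs.
Qed.

Lemma common_root_size (F : fieldType) (E : splittingFieldType F)
    (p q : {poly F}) (v : E) :
  irreducible_poly p -> irreducible_poly q ->
  root (map_poly (in_alg E) p) v -> root (map_poly (in_alg E) q) v ->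
  size p = size q.
Proof.
move=> irr_p irr_q pv qv.
rewrite -(size_map_poly (in_alg E) p) -(size_map_poly (in_alg E) q).
by rewrite -(eqp_size (minPoly1_eqp irr_p pv)) -(eqp_size (minPoly1_eqp irr_q qv)).
Qed.

Lemma irreducible_polyX (F : fieldType) : irreducible_poly ('X : {poly F}).
Proof.
split=> [|q size_q qX]; first by rewrite size_polyX.
rewrite -dvdp_size_eqp // size_polyX eqn_leq -{1}(size_polyX F).
rewrite dvdp_leq ?polyX_eq0 //.
have q0 : q != 0 by apply: contraTneq qX => ->; rewrite dvd0p polyX_eq0.
by rewrite ltn_neqAle eq_sym size_q size_poly_gt0.
Qed.

(** * From factor degrees to the Steiner system *)

Section FactorDegrees.

Local Open Scope fset_scope.
Variables (F : fieldType) (E : splittingFieldType F) (f p : {poly F}) (n : nat).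
Variable (P : {fset E}).
Hypothesis char2 : 2%N \in [pchar F].
Hypothesis f_irr : irreducible_poly f.
Hypothesis f_sep : separable_poly f.
Hypothesis f_split : splittingFieldFor 1%VS (map_poly (in_alg E) f) {:E}%VS.
Hypothesis f_size : size f = 25%N.
Hypothesis f_dvd : f %| p.
Hypothesis p_two : two_degree p n.
Hypothesis p_factors : irreducible_factor_degrees p factor_degrees.
Hypothesis P_roots : forall x, (x \in P) = root (map_poly (in_alg E) f) x.
Hypothesis P_card : #|` P| = 24%N.

Local Notation w := (subset_sum (val : P -> E)).

Lemma addvv_E (v : E) : (v + v = 0)%R.
Proof. by apply: addrr_pchar2; rewrite (fmorph_pchar (in_alg E)). Qed.

Lemma galois_E : galois 1 {:E}.
Proof.
apply/splitting_galoisField; exists (map_poly (in_alg E) f).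
by rewrite alg_polyOver separable_map.
Qed.

Lemma P_gal_stable (x : gal_of {:E}) : x \in 'Gal({:E} / 1)%g ->
  forall a, a \in P -> x a \in P.
Proof.
move=> Gx a; rewrite !P_roots => fa.
rewrite -(fixedPoly_gal (sub1v _) Gx (alg_polyOver 1 f)).
by rewrite (rmorph_root x).
Qed.

Lemma root_p_sum (S : {set P}) : root (map_poly (in_alg E) p) (w S).
Proof.
rewrite /subset_sum; elim/big_ind: _ => [|u v|x _].
- exact: two_poly_root0 p_two.
- rewrite /root (two_poly_hornerD _ _ char2 p_two) => /eqP-> /eqP->.
  by rewrite addr0.
have: root (map_poly (in_alg E) f) (val x) by rewrite -P_roots; apply: valP.
by rewrite !root_factor_theorem => /dvdp_trans-> //; rewrite dvdp_map.
Qed.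

Lemma zero_sum_structure :
  no_zero_sum_upto (val : P -> E) 7 /\
  forall S : {set P}, #|S| = 4%N -> #|ksubsets (val : P -> E) 4 (w S)| = 6%N.
Proof.
have [qs [qs_irr qs_prod qs_deg]] := p_factors.
(* The degrees are distinct, so the degree alone identifies a factor and can index its set of
   roots. *)
pose O d (v : E) :=
  has (fun q : {poly F} => ((size q).-1 == d) && root (map_poly (in_alg E) q) v) qs.
have rootO v : root (map_poly (in_alg E) p) v ->
    exists2 q, q \in qs & root (map_poly (in_alg E) q) v.
  have: map_poly (in_alg E) p %= map_poly (in_alg E) (\prod_(q <- qs) q).
    by rewrite eqp_map.
  move/eqp_root->; rewrite rmorph_prod /root horner_prod prodf_seq_eq0.
  by case/hasP=> q q_qs qv; exists q.
have qs_uniq : uniq [seq (size (q : {poly F})).-1 | q <- qs].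
  by rewrite (perm_uniq qs_deg).
have qs_inj := map_uniq_inj qs_uniq.
have O_root q v : q \in qs -> root (map_poly (in_alg E) q) v ->
    forall d, O d v = ((size q).-1 == d).
  move=> q_qs qv d; apply/hasP/eqP => [[r r_qs /andP[/eqP<- rv]] | <-].
    by rewrite (common_root_size (qs_irr _ q_qs) (qs_irr _ r_qs) qv rv).
  by exists q; rewrite ?eqxx.
(* Here [r] need not occur in [qs]: sharing a root forces the same degree. This is applied to ['X]
   at 0 and to [f] at its roots. *)
have O_unit d r v : irreducible_poly r -> root (map_poly (in_alg E) r) v ->
    root (map_poly (in_alg E) p) v -> (size r).-1 = d -> O d v.
  move=> r_irr rv /rootO[q q_qs qv] <-; rewrite (O_root q) //.
  by rewrite (common_root_size (qs_irr _ q_qs) r_irr qv rv).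
apply: (min_weight_and_sextets addvv_E (O := O)).
- by rewrite -cardfE.
- move=> S; have [q q_qs qS] := rootO _ (root_p_sum S).
  rewrite (eq_count (O_root q _ q_qs qS)) //.
  have := count_uniq_mem (size q).-1 (isT : uniq factor_degrees).
  have -> : (size q).-1 \in factor_degrees.
    by rewrite -(perm_mem qs_deg); apply: (map_f (fun r : {poly F} => (size r).-1)).
  move=> e; rewrite -[RHS]e.
  by apply: eq_count => d; rewrite /= eq_sym.
- move=> d k; rewrite -(perm_mem qs_deg) => /mapP[q q_qs ->].
  have OE v : O (size q).-1 v = root (map_poly (in_alg E) q) v.
    apply/hasP/idP => [[r r_qs /andP[/eqP eqr rv]] | qv]; last first.
      by exists q; rewrite ?eqxx.
    by rewrite -(qs_inj _ _ r_qs q_qs eqr).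
  have [m [Nm cm]] := card_ksubsets_orbit galois_E P_gal_stable k (qs_irr _ q_qs).
  exists m; split=> [v|]; first by rewrite OE; apply: Nm.
  by rewrite -cm; apply: eq_card => S; rewrite !inE OE.
- exact: val_inj.
- apply: (O_unit _ 'X); rewrite ?size_polyX ?map_polyX ?rootX //.
    exact: irreducible_polyX.
  exact: two_poly_root0 p_two.
move=> x; have fx : root (map_poly (in_alg E) f) (val x).
  by rewrite -P_roots; apply: valP.
apply: (O_unit _ f) => //; last by rewrite f_size.
by have := root_p_sum [set x]; rewrite /subset_sum big_set1.
Qed.

Theorem steiner_of_factor_degrees :
  steiner_system 5 8 24 P (zero_sum_subsets 8 P) /\
  #|` zero_sum_subsets 8 P| = 759%N.
Proof.
have [nz7 sextet] := zero_sum_structure.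
have P24 : #|{: P}| = 24%N by rewrite -cardfE.
split; last by rewrite card_zero_sum_subsets (card_octads addvv_E nz7 P24 sextet).
apply: steiner_system_fsetval P_card _ _ => [A|A B C].
  exact: octad_exists addvv_E nz7 P24 sextet _.
exact: (octad_unique addvv_E nz7).
Qed.

End FactorDegrees.

(** * Splitting fields and the trinomial *)

Lemma splitting_roots (F : fieldType) (E : fieldExtType F) (p : {poly F}) :
  separable_poly p -> splittingFieldFor 1%VS (map_poly (in_alg E) p) {:E}%VS ->
  exists P : {fset E}, (forall x, (x \in P) = root (map_poly (in_alg E) p) x)
    /\ #|` P| = (size p).-1.
Proof.
move=> p_sep [rs p_rs _]; exists [fset x in rs]%fset; split=> [x|].
  by rewrite !inE (eqp_root p_rs) root_prod_XsubC.
have rs_uniq : uniq rs.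
  by rewrite -separable_prod_XsubC -(eqp_separable p_rs) separable_map.
rewrite card_fseq undup_id // -(size_map_poly (in_alg E)) (eqp_size p_rs).
by rewrite size_prod_XsubC.
Qed.

Lemma pchar_F2t : 2%N \in [pchar F2t].
Proof.
apply: (rmorph_pchar (@tofrac {poly 'F_2})).
by rewrite pchar_poly pchar_Fp.
Qed.

Lemma size_trinomial24 (F : fieldType) (c : F) : size ('X^24 + 'X + c%:P) = 25%N.
Proof.
rewrite -addrA size_polyDl ?size_polyXn // (leq_ltn_trans (size_polyD _ _)) //.
by rewrite size_polyX size_polyC; case: (_ != 0).
Qed.

(** As 24 is even, the derivative is 1. *)
Lemma separable_trinomial24 (F : fieldType) (c : F) :
  2%N \in [pchar F] -> separable_poly ('X^24 + 'X + c%:P).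
Proof.
move=> char2; rewrite separable_poly.unlock !derivD derivXn derivX derivC addr0.
have char2P : 2%N \in [pchar {poly F}] by rewrite pchar_poly.
rewrite (mulrnA _ 2 12) (mulrn_pchar char2P) mul0rn.
by rewrite add0r coprimep1.
Qed.

Local Open Scope fset_scope.

Theorem lemma23
  (f_irreducible : irreducible_poly f24)
  (L_minimal : minimal_two_poly f24 L24)
  (L_two_degree : two_degree L24 12)
  (L_factors : irreducible_factor_degrees L24 [:: 1; 24; 276; 1771; 2024]%N)
  (E : fieldExtType F2t)
  (E_splitting : splittingFieldFor 1%VS (map_poly (in_alg E) f24) {:E}%VS) :
  exists P : {fset E},
    [/\ forall x : E, (x \in P) = root (map_poly (in_alg E) f24) x,
        steiner_system 5 8 24 P (zero_sum_subsets 8 P)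
      & #|` zero_sum_subsets 8 P| = 759%N].
Proof.
have [P [P_roots P_card]] :=
  splitting_roots (separable_trinomial24 F2t_t pchar_F2t) E_splitting.
(* The Galois theory above needs a splitting field structure, which is built on [E] from the
   splitting hypothesis for [f24]. *)
have E_axiom : SplittingField.axiom E.
  by exists (map_poly (in_alg E) f24) => //; apply: alg_polyOver.
pose E' : splittingFieldType F2t :=
  HB.pack E (FieldExt_isSplittingField.Build F2t E E_axiom).
exists P; have [_ [_ _ f_dvd _]] := L_minimal.
rewrite size_trinomial24 in P_card.
by have [] := @steiner_of_factor_degrees
  F2t E' f24 L24 12 P pchar_F2t f_irreducible
  (separable_trinomial24 F2t_t pchar_F2t) E_splitting (size_trinomial24 F2t_t)
  f_dvd L_two_degree L_factors P_roots P_card; split.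
Qed.
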